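(* Let $X$ be an algebraic variety over $k$ with field of rational functions $K_X$, and let $\varphi\colon \mathbb{G}_{\mathrm{m}}\times X\dashrightarrow X$ be a rational $\mathbb{G}_{\mathrm{m}}$-action with comorphism $\varphi^*\colon K_X\to K_X(t)$. Then $$\operatorname{Im}(\varphi^* )\subseteq \mathcal{O}_\nu,\qquad \mathcal{O}_\nu=\{r(t)\in K_X(t)\mid \operatorname{ord}_1(r)\ge 0\},$$ where $\mathcal{O}_\nu$ is the discrete valuation ring of $K_X(t)$ associated with the order of vanishing $\operatorname{ord}_1$ at $t=1$.
   Context: Let $k$ be an algebraically closed field of characteristic zero. A variety is an integral separated scheme of finite type over $k$; $K_X$ is the field of rational functions of $X$. $\mathbb{G}_{\mathrm{m}}$ is the multiplicative group over $k$, with coordinate $t$, group law $\mu$ and neutral element $e\colon \operatorname{Spec}(k)\to\mathbb{G}_{\mathrm{m}}$. A rational $\mathbb{G}_{\mathrm{m}}$-action on $X$ is a rational map $\varphi\colon \mathbb{G}_{\mathrm{m}}\times X\dashrightarrow X$ such that, as rational maps, $\varphi\circ(\mathrm{id}_{\mathbb{G}_{\mathrm{m}}}\times\varphi)=\varphi\circ(\mu\times \mathrm{id}_X)$ on $\mathbb{G}_{\mathrm{m}}\times\mathbb{G}_{\mathrm{m}}\times X$ and $\varphi\circ(e\times \mathrm{id}_X)=\mathrm{pr}_2$ on $\operatorname{Spec}(k)\times X$. Its comorphism is the induced field homomorphism $\varphi^*\colon K_X\to k(\mathbb{G}_{\mathrm{m}}\times X)=K_X(t)$. *)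

(* Defs.v *)
From HB Require Import structures.
From Stdlib Require List.
From mathcomp Require Import all_boot all_order all_algebra.
From mathcomp Require Import fraction generic_quotient.
From mathcomp Require Import boolp classical_sets functions topology.

Set Implicit Arguments.
Unset Strict Implicit.
Unset Printing Implicit Defensive.

Import GRing.Theory.
Local Open Scope classical_set_scope.
Local Open Scope ring_scope.
Local Open Scope quotient_scope.

Record opens (T : topologicalType) := Opens {
  oset :> set T;
  oset_open : open oset }.

Definition omem (T : topologicalType) (U : opens T) : T -> Prop := oset U.
Coercion omem : opens >-> Funclass.

Lemma opens_eq (T : topologicalType) (U V : opens T) :
  (U : set T) = V -> U = V.
Proof.
case: U V => [U oU] [V oV] /= eUV; case: V / eUV oV => oV.
by rewrite (Prop_irrelevance oU oV).
Qed.

Definition ofull (T : topologicalType) : opens T := Opens (@openT T).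

Definition ocap (T : topologicalType) (U V : opens T) : opens T :=
  Opens (openI (oset_open U) (oset_open V)).

Lemma sub_full (T : topologicalType) (U : opens T) : U `<=` ofull T.
Proof. by []. Qed.

Lemma ocapl (T : topologicalType) (U V : opens T) : ocap U V `<=` U.
Proof. by move=> x []. Qed.

Lemma ocapr (T : topologicalType) (U V : opens T) : ocap U V `<=` V.
Proof. by move=> x []. Qed.

(* The rings of sections are [comPzRingType]s because the ring of sections
   over the empty set is the zero ring.  The structure morphism to [Spec k] is
   given by the corresponding ring morphism [k -> Gamma(X, O_X)]. *)
Record ringed_space (k : fieldType) := RingedSpace {
  space :> topologicalType;
  sec : opens space -> comPzRingType;
  res : forall U V : opens space, V `<=` U -> {rmorphism sec U -> sec V};
  res_id : forall (U : opens space) (h : U `<=` U) (s : sec U), res h s = s;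
  res_res : forall (U V W : opens space) (hVU : V `<=` U) (hWV : W `<=` V)
    (hWU : W `<=` U) (s : sec U), res hWV (res hVU s) = res hWU s;
  sec_sheaf : forall (I : Type) (U : opens space) (V : I -> opens space)
    (hV : forall i, V i `<=` U), U `<=` \bigcup_i V i ->
    forall s : (forall i, sec (V i)),
    (forall i j (W : opens space) (hi : W `<=` V i) (hj : W `<=` V j),
      res hi (s i) = res hj (s j)) ->
    exists! t : sec U, forall i, res (hV i) t = s i;
  scal : {rmorphism k -> sec (ofull space)} }.

Arguments sec {k} r U.
Arguments res {k r U V} h.
Arguments scal {k} r.

(* The germ of [s] at [x] is a unit of the stalk at [x]. *)
Definition unit_at (k : fieldType) (X : ringed_space k) (U : opens X)
    (s : sec X U) (x : X) : Prop :=
  exists (V : opens X) (h : V `<=` U),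
    V x /\ exists v : sec X V, res h s * v = 1.

(* All the stalks are local rings; the first clause says that they are not
   zero. *)
Definition local_stalks (k : fieldType) (X : ringed_space k) : Prop :=
  forall (x : X) (U : opens X), U x ->
    ~ unit_at (0 : sec X U) x /\
    forall s : sec X U, unit_at s x \/ unit_at (1 - s) x.

Record lrspace (k : fieldType) := LRSpace {
  lrs_rs :> ringed_space k;
  lrs_local : local_stalks lrs_rs }.

(* A morphism of locally ringed spaces over [k] from the open subspace [pdom]
   of [Y] to [X].  The values of [pfun] outside [pdom] are irrelevant.  The map
   of sheaves is given by its components [O_X(V) -> O_Y(W)] for all pairs of
   open sets with [pfun W] contained in [V]. *)
Record pmor (k : fieldType) (Y X : lrspace k) := PMor {
  pdom : opens Y;
  pfun : Y -> X;
  pcont : forall V : opens X, open (pdom `&` pfun @^-1` V);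
  psharp : forall (V : opens X) (W : opens Y),
    W `<=` pdom `&` pfun @^-1` V -> {rmorphism sec X V -> sec Y W};
  psharp_res : forall (V V' : opens X) (W W' : opens Y)
    (h : W `<=` pdom `&` pfun @^-1` V) (h' : W' `<=` pdom `&` pfun @^-1` V')
    (hV : V' `<=` V) (hW : W' `<=` W) (s : sec X V),
    res hW (psharp h s) = psharp h' (res hV s);
  psharp_scal : forall (W : opens Y)
    (h : W `<=` pdom `&` pfun @^-1` (ofull X)) (a : k),
    psharp h (scal X a) = res (@sub_full Y W) (scal Y a);
  psharp_local : forall (V : opens X) (W : opens Y)
    (h : W `<=` pdom `&` pfun @^-1` V) (s : sec X V) (y : Y), W y ->
    unit_at (psharp h s) y -> unit_at s (pfun y) }.

Arguments psharp {k Y X} p {V W} h.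

Record mor (k : fieldType) (Y X : lrspace k) := Mor {
  mor_pmor :> pmor Y X;
  mor_total : forall y, pdom mor_pmor y }.

Definition ppre (k : fieldType) (Y X : lrspace k) (f : pmor Y X)
    (V : opens X) : opens Y := Opens (pcont f V).

(* [f] and [g] are both defined on [W] and have the same restriction to it. *)
Definition agree_on (k : fieldType) (Y X : lrspace k) (W : opens Y)
    (f g : pmor Y X) : Prop :=
  [/\ W `<=` pdom f, W `<=` pdom g, (forall y, W y -> pfun f y = pfun g y) &
      forall (V : opens X) (W' : opens Y) (hf : W' `<=` pdom f `&` pfun f @^-1` V)
        (hg : W' `<=` pdom g `&` pfun g @^-1` V) (s : sec X V),
        W' `<=` W -> psharp f hf s = psharp g hg s].

Definition mor_eq (k : fieldType) (Y X : lrspace k) (f g : pmor Y X) : Prop :=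
  agree_on (ofull Y) f g.

Section Identity.
Variables (k : fieldType) (X : lrspace k).

Let id_cont (V : opens X) : open (ofull X `&` id @^-1` V).
Proof. by apply: openI; [exact: openT | exact: oset_open]. Qed.

Let id_sub (V W : opens X) (h : W `<=` ofull X `&` id @^-1` V) : W `<=` V.
Proof. by move=> x /h []. Qed.

Let id_sharp (V W : opens X) (h : W `<=` ofull X `&` id @^-1` V) :
  {rmorphism sec X V -> sec X W} := res (id_sub h).

Let id_res (V V' : opens X) (W W' : opens X)
    (h : W `<=` ofull X `&` id @^-1` V) (h' : W' `<=` ofull X `&` id @^-1` V')
    (hV : V' `<=` V) (hW : W' `<=` W) (s : sec X V) :
  res hW (id_sharp h s) = id_sharp h' (res hV s).
Proof.
have hWV : W' `<=` V by apply: subset_trans hW (id_sub h).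
by rewrite /id_sharp (res_res (id_sub h) hW hWV) (res_res hV (id_sub h') hWV).
Qed.

Let id_scal (W : opens X) (h : W `<=` ofull X `&` id @^-1` (ofull X)) (a : k) :
  id_sharp h (scal X a) = res (@sub_full X W) (scal X a).
Proof. by rewrite /id_sharp (Prop_irrelevance (id_sub h) (@sub_full X W)). Qed.

Let id_local (V : opens X) (W : opens X) (h : W `<=` ofull X `&` id @^-1` V)
    (s : sec X V) (x : X) : W x -> unit_at (id_sharp h s) x -> unit_at s (id x).
Proof.
move=> _ [V' [hV' [V'x [v sv]]]].
have hVV : V' `<=` V by apply: subset_trans hV' (id_sub h).
exists V', hVV; split=> //; exists v.
by rewrite -(res_res (id_sub h) hV' hVV).
Qed.

Definition idmor : mor X X :=
  @Mor k X X (PMor id_cont id_res id_scal id_local) (fun _ => I).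

End Identity.

(* The composite [g \o f], defined at the points of [pdom f] that [f] maps into
   [pdom g]. *)
Section Composition.
Variables (k : fieldType) (Y X Z : lrspace k) (g : pmor X Z) (f : pmor Y X).

Let cdom : opens Y := ppre f (pdom g).
Let cfun : Y -> Z := pfun g \o pfun f.

Let comp_cont (V : opens Z) : open (cdom `&` cfun @^-1` V).
Proof.
rewrite (_ : _ `&` _ = ppre f (ppre g V)); first exact: oset_open.
by apply/seteqP; split=> y /=; [move=> [[? ?] ?] | move=> [? [? ?]]].
Qed.

Let comp_sub (V : opens Z) (W : opens Y) (h : W `<=` cdom `&` cfun @^-1` V) :
  W `<=` pdom f `&` pfun f @^-1` (ppre g V).
Proof. by move=> y /h [[? ?] ?]. Qed.

Let comp_sharp (V : opens Z) (W : opens Y) (h : W `<=` cdom `&` cfun @^-1` V) :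
    {rmorphism sec Z V -> sec Y W} :=
  psharp f (comp_sub h) \o psharp g (@subset_refl _ (ppre g V)).

Let comp_res (V V' : opens Z) (W W' : opens Y)
    (h : W `<=` cdom `&` cfun @^-1` V) (h' : W' `<=` cdom `&` cfun @^-1` V')
    (hV : V' `<=` V) (hW : W' `<=` W) (s : sec Z V) :
  res hW (comp_sharp h s) = comp_sharp h' (res hV s).
Proof.
have hp : ppre g V' `<=` ppre g V by move=> x [? ?]; split=> //; exact: hV.
rewrite /= (psharp_res (comp_sub h) (comp_sub h') hp).
by rewrite (psharp_res _ (@subset_refl _ (ppre g V')) hV).
Qed.

Let comp_scal (W : opens Y) (h : W `<=` cdom `&` cfun @^-1` (ofull Z)) (a : k) :
  comp_sharp h (scal Z a) = res (@sub_full Y W) (scal Y a).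
Proof.
have h' : W `<=` pdom f `&` pfun f @^-1` (ofull X) by move=> y /h [[? ?] ?].
rewrite /= psharp_scal.
by rewrite -(psharp_res h' _ _ (@subset_refl _ W)) psharp_scal res_id.
Qed.

Let comp_local (V : opens Z) (W : opens Y) (h : W `<=` cdom `&` cfun @^-1` V)
    (s : sec Z V) (y : Y) :
  W y -> unit_at (comp_sharp h s) y -> unit_at s (cfun y).
Proof.
move=> Wy /(psharp_local Wy) /psharp_local; apply.
by have [[? ?] ?] := h _ Wy.
Qed.

Definition pcomp : pmor Y Z := PMor comp_cont comp_res comp_scal comp_local.

End Composition.

Lemma mor_sub (k : fieldType) (Y X : lrspace k) (f : mor Y X) :
  ofull Y `<=` pdom f `&` pfun f @^-1` (ofull X).
Proof. by move=> y _; split; first exact: mor_total. Qed.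

Definition gpull (k : fieldType) (Y X : lrspace k) (f : mor Y X)
    (s : sec X (ofull X)) : sec Y (ofull Y) :=
  psharp f (mor_sub f) s.

(* The universal property is required against all locally ringed spaces; the
   fibre product of schemes has it. *)
Definition is_product (k : fieldType) (A B P : lrspace k)
    (p : mor P A) (q : mor P B) : Prop :=
  forall (T : lrspace k) (f : mor T A) (g : mor T B),
  exists h : mor T P,
    [/\ mor_eq (pcomp p h) f, mor_eq (pcomp q h) g &
        forall h' : mor T P, mor_eq (pcomp p h') f -> mor_eq (pcomp q h') g ->
          mor_eq h' h].

Definition prime_ideal (R : comPzRingType) (P : R -> Prop) : Prop :=
  [/\ P 0 /\ ~ P 1, (forall a b, P a -> P b -> P (a + b)),
      (forall a b, P b -> P (a * b)) &
      (forall a b, P (a * b) -> P a \/ P b)].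

Definition nonvanishing (k : fieldType) (X : ringed_space k) (U : opens X)
    (f : sec X U) : set X := [set x | U x /\ unit_at f x].

(* [U] is affine: the canonical morphism from [U] to [Spec A], where
   [A = O_X(U)], is an isomorphism.  The three clauses say that it is bijective,
   that it is a homeomorphism, and that [A_f -> O_X(D(f))] is an isomorphism for
   all [f] in [A]. *)
Definition affine (k : fieldType) (X : ringed_space k) (U : opens X) : Prop :=
  [/\ (forall P : sec X U -> Prop, prime_ideal P ->
        exists! x : X, U x /\ forall f, P f <-> ~ unit_at f x),
      (forall (V : opens X) (x : X), V `<=` U -> V x ->
        exists f : sec X U, nonvanishing f x /\ nonvanishing f `<=` V) &
      (forall (f : sec X U) (V : opens X) (h : V `<=` U),
        (V : set X) = nonvanishing f ->
        (forall s : sec X V, exists (n : nat) (a : sec X U),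
          res h a = res h f ^+ n * s) /\
        (forall a : sec X U, res h a = 0 -> exists n : nat, f ^+ n * a = 0))].

Definition is_scheme (k : fieldType) (X : ringed_space k) : Prop :=
  forall x : X, exists U : opens X, U x /\ affine U.

Definition fin_gen_alg (k : fieldType) (X : ringed_space k) (U : opens X) : Prop :=
  exists gs : seq (sec X U), forall S : sec X U -> Prop,
    (forall a : k, S (res (@sub_full X U) (scal X a))) ->
    (forall s, List.In s gs -> S s) ->
    (forall s t, S s -> S t -> S (s + t)) ->
    (forall s t, S s -> S t -> S (s * t)) ->
    forall s, S s.

Definition finite_type (k : fieldType) (X : ringed_space k) : Prop :=
  exists Us : seq (opens X),
    (forall U, List.In U Us -> affine U /\ fin_gen_alg U) /\
    (forall x : X, exists2 U : opens X, List.In U Us & U x).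

Definition integral (k : fieldType) (X : ringed_space k) : Prop :=
  (exists x : X, True) /\
  forall U : opens X, U !=set0 ->
    (1 : sec X U) <> 0 /\
    forall a b : sec X U, a * b = 0 -> a = 0 \/ b = 0.

Definition closed_immersion (k : fieldType) (Y X : lrspace k) (f : mor Y X) :
    Prop :=
  [/\ injective (pfun f),
      (forall C : set Y, closed C -> closed (pfun f @` C)) &
      (forall (y : Y) (W : opens Y) (s : sec Y W), W y ->
        exists (V : opens X) (W' : opens Y) (hW : W' `<=` W)
          (h : W' `<=` pdom f `&` pfun f @^-1` V) (s' : sec X V),
          W' y /\ psharp f h s' = res hW s)].

Definition separated (k : fieldType) (X : lrspace k) : Prop :=
  forall (P : lrspace k) (p q : mor P X) (d : mor X P), is_product p q ->
    mor_eq (pcomp p d) (idmor X) -> mor_eq (pcomp q d) (idmor X) ->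
    closed_immersion d.

Record variety (k : fieldType) := Variety {
  var_lrs :> lrspace k;
  var_scheme : is_scheme var_lrs;
  var_integral : integral var_lrs;
  var_separated : separated var_lrs;
  var_finite_type : finite_type var_lrs }.

Lemma sec_empty (k : fieldType) (X : ringed_space k) (U : opens X) :
  ~ (U !=set0) -> forall s t : sec X U, s = t.
Proof.
move=> U0 s t.
have hV (i : False) : (False_rect (opens X) i : set X) `<=` U by case: i.
have cov : U `<=` \bigcup_(i in @setT False) (False_rect (opens X) i : set X).
  by move=> x Ux; case: U0; exists x.
have [|u [_ uu]] := sec_sheaf hV cov (s := fun i => False_rect _ i).
  by case.
by rewrite -(uu s (fun i => False_ind _ i)) (uu t (fun i => False_ind _ i)).
Qed.

Lemma sec_local (k : fieldType) (X : ringed_space k) (U V1 V2 : opens X)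
    (h1 : V1 `<=` U) (h2 : V2 `<=` U) : U `<=` V1 `|` V2 ->
  forall s t : sec X U, res h1 s = res h1 t -> res h2 s = res h2 t -> s = t.
Proof.
move=> cov s t e1 e2.
pose V (b : bool) := if b then V1 else V2.
have hV (b : bool) : V b `<=` U by case: b.
have covV : U `<=` \bigcup_b V b.
  by move=> x /cov [] ?; [exists true | exists false].
have eres b : res (hV b) s = res (hV b) t.
  case: b; [move: (hV true) | move: (hV false)] => /= h.
  - by rewrite (Prop_irrelevance h h1).
  - by rewrite (Prop_irrelevance h h2).
have [|u [_ uu]] := sec_sheaf hV covV (s := fun b => res (hV b) s).
  move=> i j W hi hj.
  have hW : W `<=` U := subset_trans hi (hV i).
  by rewrite (res_res (hV i) hi hW) (res_res (hV j) hj hW).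
by rewrite -(uu s) // (uu t) // => b; rewrite eres.
Qed.

Lemma integral_irreducible (k : fieldType) (X : ringed_space k) :
  integral X -> forall U V : opens X, U !=set0 -> V !=set0 -> ocap U V !=set0.
Proof.
move=> [_ iX] U V U0 V0; apply: contrapT => UV0.
pose W : opens X := Opens (openU (oset_open U) (oset_open V)).
pose S (b : bool) := if b then U else V.
have hS (b : bool) : S b `<=` W by case: b => x Sx; [left | right].
have cov : W `<=` \bigcup_b S b.
  by move=> x [] ?; [exists true | exists false].
have glue (s : sec X U) (t : sec X V) : exists w : sec X W,
    res (hS true) w = s /\ res (hS false) w = t.
  pose st (b : bool) : sec X (S b) :=
    match b return sec X (S b) with true => s | false => t end.
  have [|w [ws _]] := sec_sheaf hS cov (s := st); last first.
    by exists w; split; [exact: (ws true) | exact: (ws false)].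
  move=> i j Z hi hj; have [eij|neij] := eqVneq i j.
    by move: eij hi hj => -> hi hj; rewrite (Prop_irrelevance hi hj).
  apply: sec_empty => -[z Zz]; apply: UV0; exists z.
  by case: i j neij hi hj => -[] // _ /(_ z Zz) ? /(_ z Zz) ?.
have [a [a1 a2]] := glue 1 0; have [b [b1 b2]] := glue 0 1.
have W0 : W !=set0 by case: U0 => x; exists x; left.
have [_ dW] := iX W W0.
have [nU _] := iX U U0; have [nV _] := iX V V0.
have ab0 : a * b = 0.
  apply: (sec_local (h1 := hS true) (h2 := hS false)) => //.
  - by rewrite rmorphM rmorph0 b1 mulr0.
  - by rewrite rmorphM rmorph0 a2 mul0r.
case: (dW _ _ ab0) => e0.
- by apply: nU; rewrite -a1 e0 rmorph0.
- by apply: nV; rewrite -b2 e0 rmorph0.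
Qed.

Section FunctionField.
Variables (k : fieldType) (X : variety k).

(* [K_X] is the colimit of the [O_X(U)] over the nonempty open sets [U]. *)
Record local_section := LocalSection {
  lsdom : opens X;
  lsdom_ne : lsdom !=set0;
  lsval : sec X lsdom }.

HB.instance Definition _ := gen_eqMixin local_section.
HB.instance Definition _ := gen_choiceMixin local_section.

Definition ls_eq (a b : local_section) : bool :=
  `[< exists (W : opens X) (ha : W `<=` lsdom a) (hb : W `<=` lsdom b),
        W !=set0 /\ res ha (lsval a) = res hb (lsval b) >].

Let ls_refl : reflexive ls_eq.
Proof.
move=> a; apply/asboolP; exists (lsdom a), (@subset_refl _ _), (@subset_refl _ _).
by split=> //; exact: lsdom_ne.
Qed.

Let ls_sym : symmetric ls_eq.
Proof.
by move=> a b; apply/asboolP/asboolP => -[W [ha [hb [W0 e]]]]; exists W, hb, ha.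
Qed.

Let ls_trans : transitive ls_eq.
Proof.
move=> b a c /asboolP[W [ha [hb [W0 e]]]] /asboolP[W' [hb' [hc [W'0 e']]]].
apply/asboolP; exists (ocap W W').
have h1 : ocap W W' `<=` lsdom a by move=> x [/ha].
have h2 : ocap W W' `<=` lsdom c by move=> x [_ /hc].
have h3 : ocap W W' `<=` lsdom b by move=> x [/hb].
exists h1, h2; split; first exact: integral_irreducible (var_integral X) _ _ W0 W'0.
rewrite -(res_res ha (@ocapl _ W W') h1) e (res_res _ _ h3).
by rewrite -(res_res hb' (@ocapr _ W W') h3) e' (res_res _ _ h2).
Qed.

Canonical ls_equiv := EquivRel ls_eq ls_refl ls_sym ls_trans.

Definition ratfun := {eq_quot ls_eq}.

HB.instance Definition _ := Choice.on ratfun.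

Definition ratof (U : opens X) (U0 : U !=set0) (s : sec X U) : ratfun :=
  \pi_ratfun (LocalSection U0 s).

Lemma ratof_eq (U V : opens X) (U0 : U !=set0) (V0 : V !=set0)
    (s : sec X U) (t : sec X V) :
  ratof U0 s = ratof V0 t <->
  exists (W : opens X) (hU : W `<=` U) (hV : W `<=` V),
    W !=set0 /\ res hU s = res hV t.
Proof.
rewrite /ratof; split.
- by move=> /eqP; rewrite eqmodE /= => /asboolP.
- by move=> st; apply/eqP; rewrite eqmodE /=; apply/asboolP.
Qed.

Lemma ratofP (a : ratfun) : exists (U : opens X) (U0 : U !=set0) (s : sec X U),
  a = ratof U0 s.
Proof.
elim/quotW: a => -[U U0 s]; exists U, U0, s; by [].
Qed.

Lemma ratof_res (U V : opens X) (U0 : U !=set0) (V0 : V !=set0) (h : V `<=` U)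
    (s : sec X U) : ratof U0 s = ratof V0 (res h s).
Proof.
by apply/ratof_eq; exists V, h, (@subset_refl _ _); rewrite res_id.
Qed.

Lemma ocap_ne (U V : opens X) : U !=set0 -> V !=set0 -> ocap U V !=set0.
Proof. exact: integral_irreducible (var_integral X) _ _. Qed.

Lemma full_ne : ofull X !=set0.
Proof. by have [[x _] _] := var_integral X; exists x. Qed.

Lemma ratof2 (a b : ratfun) : exists (U : opens X) (U0 : U !=set0)
  (s t : sec X U), a = ratof U0 s /\ b = ratof U0 t.
Proof.
have [U [U0 [s ->]]] := ratofP a; have [V [V0 [t ->]]] := ratofP b.
have W0 := ocap_ne U0 V0; exists (ocap U V), W0.
by exists (res (@ocapl _ U V) s), (res (@ocapr _ U V) t); rewrite -!ratof_res.
Qed.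

Lemma ratof3 (a b c : ratfun) : exists (U : opens X) (U0 : U !=set0)
  (s t u : sec X U), [/\ a = ratof U0 s, b = ratof U0 t & c = ratof U0 u].
Proof.
have [U [U0 [s [t [-> ->]]]]] := ratof2 a b; have [V [V0 [u ->]]] := ratofP c.
have W0 := ocap_ne U0 V0; exists (ocap U V), W0.
exists (res (@ocapl _ U V) s), (res (@ocapl _ U V) t), (res (@ocapr _ U V) u).
by rewrite -!ratof_res.
Qed.

Definition ls_op2 (op : forall R : comPzRingType, R -> R -> R)
    (a b : local_section) : ratfun :=
  ratof (ocap_ne (lsdom_ne a) (lsdom_ne b))
    (op _ (res (@ocapl _ _ _) (lsval a)) (res (@ocapr _ _ _) (lsval b))).

Definition rat_add (a b : ratfun) : ratfun :=
  ls_op2 (fun R => +%R) (repr a) (repr b).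
Definition rat_mul (a b : ratfun) : ratfun :=
  ls_op2 (fun R => *%R) (repr a) (repr b).
Definition rat_opp (a : ratfun) : ratfun :=
  ratof (lsdom_ne (repr a)) (- lsval (repr a)).
Definition rat_zero : ratfun := ratof full_ne 0.
Definition rat_one : ratfun := ratof full_ne 1.

Let ls_op2E (op : forall R : comPzRingType, R -> R -> R)
    (opM : forall (R S : comPzRingType) (f : {rmorphism R -> S}),
      {morph f : x y / op R x y >-> op S x y})
    (U : opens X) (U0 : U !=set0) (s t : sec X U) :
  ls_op2 op (repr (ratof U0 s)) (repr (ratof U0 t)) = ratof U0 (op _ s t).
Proof.
set a := repr (ratof U0 s); set b := repr (ratof U0 t).
have ea : ratof (lsdom_ne a) (lsval a) = ratof U0 s.
  by rewrite -[RHS]reprK -/a /ratof; case: (a).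
have eb : ratof (lsdom_ne b) (lsval b) = ratof U0 t.
  by rewrite -[RHS]reprK -/b /ratof; case: (b).
have [Wa [ha [hUa [Wa0 {}ea]]]] := (ratof_eq _ _ _ _).1 ea.
have [Wb [hb [hUb [Wb0 {}eb]]]] := (ratof_eq _ _ _ _).1 eb.
apply/ratof_eq; exists (ocap Wa Wb).
have h1 : ocap Wa Wb `<=` ocap (lsdom a) (lsdom b) by move=> x [/ha ? /hb].
have h2 : ocap Wa Wb `<=` U by move=> x [/hUa].
have h1a : ocap Wa Wb `<=` lsdom a by move=> x [/ha].
have h1b : ocap Wa Wb `<=` lsdom b by move=> x [_ /hb].
exists h1, h2; split; first exact: ocap_ne.
rewrite !opM (res_res _ _ h1a) (res_res _ _ h1b).
rewrite -(res_res ha (@ocapl _ Wa Wb) h1a) -(res_res hb (@ocapr _ Wa Wb) h1b).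
by rewrite ea eb (res_res _ _ h2) (res_res _ _ h2).
Qed.

Lemma rat_addE (U : opens X) (U0 : U !=set0) (s t : sec X U) :
  rat_add (ratof U0 s) (ratof U0 t) = ratof U0 (s + t).
Proof. by apply: (ls_op2E (op := fun R => +%R)) => R S f x y; rewrite rmorphD. Qed.

Lemma rat_mulE (U : opens X) (U0 : U !=set0) (s t : sec X U) :
  rat_mul (ratof U0 s) (ratof U0 t) = ratof U0 (s * t).
Proof. by apply: (ls_op2E (op := fun R => *%R)) => R S f x y; rewrite rmorphM. Qed.

Lemma rat_oppE (U : opens X) (U0 : U !=set0) (s : sec X U) :
  rat_opp (ratof U0 s) = ratof U0 (- s).
Proof.
rewrite /rat_opp; set a := repr (ratof U0 s).
have ea : ratof (lsdom_ne a) (lsval a) = ratof U0 s.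
  by rewrite -[RHS]reprK -/a /ratof; case: (a).
have [W [ha [hU [W0 {}ea]]]] := (ratof_eq _ _ _ _).1 ea.
by apply/ratof_eq; exists W, ha, hU; rewrite !rmorphN ea.
Qed.

Lemma rat_zeroE (U : opens X) (U0 : U !=set0) : rat_zero = ratof U0 0.
Proof. by rewrite /rat_zero (ratof_res _ U0 (@sub_full X U)) rmorph0. Qed.

Lemma rat_oneE (U : opens X) (U0 : U !=set0) : rat_one = ratof U0 1.
Proof. by rewrite /rat_one (ratof_res _ U0 (@sub_full X U)) rmorph1. Qed.

Let rat_addA : associative rat_add.
Proof.
move=> a b c; have [U [U0 [s [t [u [-> -> ->]]]]]] := ratof3 a b c.
by rewrite !rat_addE addrA.
Qed.

Let rat_addC : commutative rat_add.
Proof.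
move=> a b; have [U [U0 [s [t [-> ->]]]]] := ratof2 a b.
by rewrite !rat_addE addrC.
Qed.

Let rat_add0 : left_id rat_zero rat_add.
Proof.
move=> a; have [U [U0 [s ->]]] := ratofP a.
by rewrite (rat_zeroE U0) rat_addE add0r.
Qed.

Let rat_addN : left_inverse rat_zero rat_opp rat_add.
Proof.
move=> a; have [U [U0 [s ->]]] := ratofP a.
by rewrite (rat_zeroE U0) rat_oppE rat_addE addNr.
Qed.

HB.instance Definition _ :=
  GRing.isZmodule.Build ratfun rat_addA rat_addC rat_add0 rat_addN.

Let rat_mulA : associative rat_mul.
Proof.
move=> a b c; have [U [U0 [s [t [u [-> -> ->]]]]]] := ratof3 a b c.
by rewrite !rat_mulE mulrA.
Qed.

Let rat_mulC : commutative rat_mul.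
Proof.
move=> a b; have [U [U0 [s [t [-> ->]]]]] := ratof2 a b.
by rewrite !rat_mulE mulrC.
Qed.

Let rat_mul1 : left_id rat_one rat_mul.
Proof.
move=> a; have [U [U0 [s ->]]] := ratofP a.
by rewrite (rat_oneE U0) rat_mulE mul1r.
Qed.

Let rat_mulDl : left_distributive rat_mul rat_add.
Proof.
move=> a b c; have [U [U0 [s [t [u [-> -> ->]]]]]] := ratof3 a b c.
by rewrite !rat_addE !rat_mulE rat_addE mulrDl.
Qed.

Let rat_neq0 : rat_one != rat_zero.
Proof.
apply/eqP => /ratof_eq [W [h [h' [W0]]]]; rewrite rmorph1 rmorph0 => e.
by have [_ /(_ W W0) [/(_ e)]] := var_integral X.
Qed.

HB.instance Definition _ :=
  GRing.Zmodule_isComNzRing.Build ratfun rat_mulA rat_mulC rat_mul1 rat_mulDl rat_neq0.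

Lemma rat_inv_exists (a : ratfun) : a != 0 -> exists b, b * a = 1.
Proof.
have [U [U0 [s ->]]] := ratofP a => s0.
have [x Ux] := U0; have [V [Vx affV]] := var_scheme x.
have V0 : V !=set0 by exists x.
have [primes basis loc] := affV.
have [_ iX] := var_integral X; have [nV dV] := iX V V0.
have [|eta [[Veta eta0] _]] := primes (fun f => f = 0).
  split; [by split | by move=> ? ? -> ->; rewrite addr0 |
          by move=> ? ? ->; rewrite mulr0 | exact: dV].
have inW (W : opens X) : W !=set0 -> W eta.
  move=> W0; have [y [Vy Wy]] := ocap_ne V0 W0.
  have [f [[_ fy] fW]] := basis (ocap V W) y (@ocapl _ V W) (conj Vy Wy).
  suff /fW [] : nonvanishing f eta by [].
  split=> //; apply: contrapT => /eta0 f0; case: ((@lrs_local _ X y V Vy).1).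
  by rewrite -f0.
have [f [[_ feta] fU]] :=
  basis (ocap V U) eta (@ocapl _ V U) (conj Veta (inW _ U0)).
have hE : nonvanishing f `<=` V by move=> y [].
have oE : open (nonvanishing f).
  rewrite openE => y [Vy [E [hE' [Ey [w fw]]]]].
  rewrite /interior nbhsE; exists E; first by split=> //; exact: oset_open.
  by move=> z Ez; split; [exact (hE' _ Ez) | exists E, hE'; split=> //; exists w].
pose E : opens X := Opens oE.
have E0 : E !=set0 by exists eta.
have hEU : E `<=` U by move=> y /fU [].
have [/(_ (res hEU s)) [n [b sb]] _] := loc f E hE erefl.
have [_ dE] := iX E E0.
have fn0 m : res (hE : E `<=` V) f ^+ m <> 0.
  elim: m => [|m IH]; first by rewrite expr0; exact: (iX E E0).1.
  rewrite exprS => /dE [] // fE0; case: feta => D [hD [Deta [v fv]]].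
  have hDE : D `<=` E.
    by move=> y Dy; split; [exact (hD _ Dy) | exists D, hD; split=> //; exists v].
  have := fv; rewrite -(res_res (hE : E `<=` V) hDE hD) fE0 rmorph0 mul0r => /esym.
  by apply: (iX D _).1; exists eta.
have b0 : b <> 0.
  move=> b0; move: sb; rewrite b0 rmorph0 => /esym /dE [/fn0 //|sE0].
  by case/eqP: s0; rewrite (ratof_res U0 E0 hEU) sE0 [RHS](rat_zeroE E0).
have [D [hD [Deta [v bv]]]] : unit_at b eta.
  by apply: contrapT => /eta0.
have F0 : ocap E D !=set0 by apply: ocap_ne => //; exists eta.
have hFE := @ocapl _ E D; have hFD := @ocapr _ E D.
exists (ratof F0 (res hFD v * res hFE (res (hE : E `<=` V) f ^+ n))).
rewrite (ratof_res U0 E0 hEU) (ratof_res E0 F0 hFE) [LHS]rat_mulE.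
rewrite -mulrA -rmorphM -sb [RHS](rat_oneE F0); congr (ratof _ _).
have hFV : ocap E D `<=` V := subset_trans hFD hD.
by rewrite (res_res _ _ hFV) -(res_res hD hFD hFV) mulrC -rmorphM bv rmorph1.
Qed.

Definition rat_inv (a : ratfun) : ratfun :=
  if pselect (exists b, b * a = 1) is left h then projT1 (cid h) else 0.

Let rat_mulV (a : ratfun) : a != 0 -> rat_inv a * a = 1.
Proof.
move=> /rat_inv_exists h; rewrite /rat_inv; case: pselect => // h'.
by case: (cid h').
Qed.

Let rat_inv0 : rat_inv 0 = 0.
Proof.
rewrite /rat_inv; case: pselect => // h; exfalso; case: h => b.
by rewrite mulr0 => /esym/eqP; rewrite oner_eq0.
Qed.

HB.instance Definition _ := GRing.ComNzRing_isField.Build ratfun rat_mulV rat_inv0.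

End FunctionField.

(* The element [b] of [K_Y] is the pullback of [a] in [K_X] along [f]. *)
Definition pulls_back (k : fieldType) (Y X : variety k) (f : pmor Y X)
    (a : ratfun X) (b : ratfun Y) : Prop :=
  exists (V : opens X) (V0 : V !=set0) (W : opens Y) (W0 : W !=set0)
    (h : W `<=` pdom f `&` pfun f @^-1` V) (s : sec X V),
    a = ratof V0 s /\ b = ratof W0 (psharp f h s).

(* A representative [(U, f)] of a rational map; equality of rational maps is
   [rat_eq], which is an equivalence relation when [Y] is a variety. *)
Record ratmap (k : fieldType) (Y X : lrspace k) := RatMap {
  rm_pmor :> pmor Y X;
  rm_ne : pdom rm_pmor !=set0 }.

Definition rat_eq (k : fieldType) (Y X : lrspace k) (f g : pmor Y X) : Prop :=
  exists2 W : opens Y, W !=set0 & agree_on W f g.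

(* The composite [g \o f] of rational maps is defined, and equal to [h]: the
   composite is defined when, for some representatives, the image of [f] meets
   the domain of [g]. *)
Definition is_rat_comp (k : fieldType) (Y X Z : lrspace k)
    (g : pmor X Z) (f : pmor Y X) (h : pmor Y Z) : Prop :=
  exists (g' : pmor X Z) (f' : pmor Y X),
    [/\ rat_eq g g', rat_eq f f', pdom (pcomp g' f') !=set0 &
        rat_eq h (pcomp g' f')].

(* [Gm], with coordinate [t], represents the functor of units.  The group law
   and the neutral element are given by [mu^* t = t1 * t2] and [e^* t = 1]. *)
Definition is_Gm (k : fieldType) (Gm : lrspace k) (t : sec Gm (ofull Gm)) : Prop :=
  (exists t', t * t' = 1) /\
  forall (T : lrspace k) (u : sec T (ofull T)), (exists u', u * u' = 1) ->
  exists h : mor T Gm, gpull h t = u /\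
    forall h' : mor T Gm, gpull h' t = u -> mor_eq h' h.

Section Action.
Variables (k : fieldType) (Gm X : lrspace k) (t : sec Gm (ofull Gm)).
(* [P = Gm * X] and [P2 = Gm * (Gm * X)]. *)
Variables (P : lrspace k) (p1 : mor P Gm) (p2 : mor P X).
Variables (P2 : lrspace k) (q1 : mor P2 Gm) (q2 : mor P2 P).

Definition is_id_times (phi : pmor P X) (psi : pmor P2 P) : Prop :=
  rat_eq (pcomp p1 psi) q1 /\ rat_eq (pcomp p2 psi) (pcomp phi q2).

Definition is_mu_times_id (m : mor P2 P) : Prop :=
  gpull m (gpull p1 t) = gpull q1 t * gpull q2 (gpull p1 t) /\
  mor_eq (pcomp p2 m) (pcomp p2 q2).

(* [Spec k * X] is identified with [X] by its second projection. *)
Definition is_e_times_id (e : mor X P) : Prop :=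
  gpull e (gpull p1 t) = 1 /\ mor_eq (pcomp p2 e) (idmor X).

Definition is_rational_action (phi : ratmap P X) : Prop :=
  (exists (psi : ratmap P2 P) (m : mor P2 P),
    [/\ is_id_times phi psi, is_mu_times_id m &
        exists h : ratmap P2 X, is_rat_comp phi psi h /\ is_rat_comp phi m h]) /\
  (exists e : mor X P, is_e_times_id e /\ is_rat_comp phi e (idmor X)).

End Action.

(* [phis : K_X -> K_X(t)] is the comorphism of [phi], through the isomorphism
   [K_X(t) = k(Gm * X)], which is the pullback by the projection on [K_X] and
   sends [t] to the coordinate of [Gm]. *)
Definition is_comorphism (k : fieldType) (Gm : lrspace k) (X P : variety k)
    (t : sec Gm (ofull Gm)) (p1 : mor P Gm) (p2 : mor P X) (phi : ratmap P X)
    (phis : {rmorphism ratfun X -> {fraction {poly ratfun X}}}) : Prop :=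
  exists iota : {rmorphism {fraction {poly ratfun X}} -> ratfun P},
    [/\ bijective iota,
        (forall a : ratfun X, pulls_back p2 a (iota (FracField.tofrac a%:P))),
        iota (FracField.tofrac 'X) = ratof (full_ne P) (gpull p1 t) &
        forall a : ratfun X, pulls_back phi a (iota (phis a))].

(* For [r = 0] this is a junk value; the order of [0] is infinite. *)
Definition ord1 (K : fieldType) (r : {fraction {poly K}}) : int :=
  (mup 1 \n_(repr r))%:Z - (mup 1 \d_(repr r))%:Z.

Definition O_nu (K : fieldType) : set {fraction {poly K}} :=
  [set r | r = 0 \/ (0 <= ord1 r)%R].

(* Main.v *)
(* Since [phi] restricts to the identity on [{1} * X], it is defined at some
   point of the section [e : X -> Gm * X], [x |-> (1, x)].  Pullback along [e]
   is thus a partially defined ring morphism from [k(Gm * X) = K_X(t)] to [K_X]: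
   it is defined on the image of [phi^*], and sends [q(t)] to [q(1)] for [q] in
   [K_X[t]].  If [r] in the image had a pole at [t = 1], we could write
   [q (t - 1) r = p] with [p(1) <> 0], and pulling back would give
   [p(1) = 0]. *)
Require Import Defs.
From HB Require Import structures.
From mathcomp Require Import all_boot all_order all_algebra.
From mathcomp Require Import fraction.
From mathcomp Require Import boolp classical_sets functions topology.
Set Implicit Arguments.
Unset Strict Implicit.
Unset Printing Implicit Defensive.
Import GRing.Theory.
Local Open Scope classical_set_scope.
Local Open Scope ring_scope.

Section PullsBack.
Variables (k : fieldType) (Y X : variety k).

Lemma rat_eq_sym (f g : pmor Y X) : Defs.rat_eq f g -> Defs.rat_eq g f.
Proof.
case=> W W0 [Wf Wg fg sfg]; exists W => //; split=> // [y /fg //|].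
by move=> V W' hg hf s hW; rewrite (sfg V W' hf hg).
Qed.

(** Shrinking [W] to [ocap W D] keeps it nonempty by irreducibility, so the class in [ratfun Y] does
    not change. *)
Lemma pulls_back_rat_eq (f g : pmor Y X) (a : ratfun X) (b : ratfun Y) :
  Defs.rat_eq f g -> pulls_back f a b -> pulls_back g a b.
Proof.
move=> [D D0 [_ Dg fg sfg]] [V [V0 [W [W0 [h [s [-> ->]]]]]]].
have WD0 := ocap_ne W0 D0.
have hf : ocap W D `<=` pdom f `&` pfun f @^-1` V by move=> y [/h].
have hg : ocap W D `<=` pdom g `&` pfun g @^-1` V.
  by move=> y [/h [_ fV] Dy]; split; [exact: Dg | rewrite /preimage /= -fg].
exists V, V0, (ocap W D), WD0, hg, s; split=> //.
rewrite (ratof_res W0 WD0 (@ocapl _ W D)); congr ratof.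
rewrite (psharp_res h hf (@subset_refl _ V)) res_id.
by apply: sfg; exact: ocapr.
Qed.

(** As [f] need not be dominant, [pulls_back] is only a relation. Over common open sets, nonempty by
    irreducibility, a single ring morphism [psharp f h] handles both pairs, so sums and products can
    be pulled back. *)
Lemma pulls_back2 (f : pmor Y X) (a a' : ratfun X) (b b' : ratfun Y) :
  pulls_back f a b -> pulls_back f a' b' ->
  exists (V : opens X) (V0 : V !=set0) (W : opens Y) (W0 : W !=set0)
    (h : W `<=` pdom f `&` pfun f @^-1` V) (s s' : sec X V),
    [/\ a = ratof V0 s, b = ratof W0 (psharp f h s),
        a' = ratof V0 s' & b' = ratof W0 (psharp f h s')].
Proof.
move=> [V [V0 [W [W0 [h [s [-> ->]]]]]]].
move=> [V' [V0' [W' [W0' [h' [s' [-> ->]]]]]]].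
have VV0 := ocap_ne V0 V0'; have WW0 := ocap_ne W0 W0'.
have hh : ocap W W' `<=` pdom f `&` pfun f @^-1` (ocap V V').
  by move=> y [/h [fy Vy] /h' [_ Vy']].
exists (ocap V V'), VV0, (ocap W W'), WW0, hh.
exists (res (@ocapl _ V V') s), (res (@ocapr _ V V') s').
split; [exact: ratof_res| |exact: ratof_res|].
- by rewrite -(psharp_res h hh _ (@ocapl _ W W')) -ratof_res.
- by rewrite -(psharp_res h' hh _ (@ocapr _ W W')) -ratof_res.
Qed.

Lemma pulls_backD (f : pmor Y X) (a a' : ratfun X) (b b' : ratfun Y) :
  pulls_back f a b -> pulls_back f a' b' -> pulls_back f (a + a') (b + b').
Proof.
move=> /pulls_back2 /[apply] -[V [V0 [W [W0 [h [s [s' [-> -> -> ->]]]]]]]].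
exists V, V0, W, W0, h, (s + s'); rewrite rmorphD.
by split; exact: rat_addE.
Qed.

Lemma pulls_backM (f : pmor Y X) (a a' : ratfun X) (b b' : ratfun Y) :
  pulls_back f a b -> pulls_back f a' b' -> pulls_back f (a * a') (b * b').
Proof.
move=> /pulls_back2 /[apply] -[V [V0 [W [W0 [h [s [s' [-> -> -> ->]]]]]]]].
exists V, V0, W, W0, h, (s * s'); rewrite rmorphM.
by split; exact: rat_mulE.
Qed.

(* If [b] is nonzero, then [f^# s] is a unit at some point [y]; as [f] is local,
   [s] is a unit at [f y], so it is not zero in [K_X]. *)
Lemma pulls_back0 (f : pmor Y X) (b : ratfun Y) : pulls_back f 0 b -> b = 0.
Proof.
move=> [V [V0 [W [W0 [h [s [s0 ->]]]]]]].
apply: contrapT => /eqP/rat_inv_exists [c].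
have [U [U0 [u ->]]] := ratofP c.
have UW0 := ocap_ne U0 W0.
rewrite (ratof_res U0 UW0 (@ocapl _ U W)) (ratof_res W0 UW0 (@ocapr _ U W)).
rewrite [X in X = _]rat_mulE [X in _ = X](rat_oneE UW0).
move=> /ratof_eq [D [hD [hD' [[y Dy]]]]]; rewrite rmorphM !rmorph1 => e1.
have hDW : D `<=` W by move=> z /hD [].
have /psharp_local : unit_at (psharp f h s) y.
  exists D, hDW; split=> //.
  exists (res hD (res (@ocapl _ U W) u)).
  by rewrite mulrC -(res_res (@ocapr _ U W) hD hDW).
case=> [|E [hE [Ey [v sv]]]]; first exact: hDW.
have E0 : E !=set0 by exists (pfun f y).
have : (1 : ratfun X) = 0 * ratof E0 v.
  by rewrite s0 (ratof_res V0 E0 hE) [RHS]rat_mulE sv; exact: rat_oneE.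
by rewrite mul0r => /eqP; rewrite oner_eq0.
Qed.

End PullsBack.

(** A rational section [f] of [g] undoes pullback along [g]: the function represented by
    [psharp g s] on [ppre g V] returns to [s]. This serves for both [p2] and the action. *)
Lemma pulls_back_section (k : fieldType) (Y X : variety k) (g : pmor Y X)
    (f : pmor X Y) (a : ratfun X) (b : ratfun Y) :
  Defs.rat_eq (idmor X) (Defs.pcomp g f) ->
  pulls_back g a b -> pulls_back f b a.
Proof.
move=> [D D0 [_ Dgf gf sgf]] [V [V0 [W [W0 [h [s [-> ->]]]]]]].
have N0 := ocap_ne D0 V0.
have hgf :
    ocap D V `<=` pdom (Defs.pcomp g f) `&` pfun (Defs.pcomp g f) @^-1` V.
  move=> x [Dx Vx]; split; first exact: Dgf.
  by rewrite /preimage /= -[pfun g _](gf x Dx).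
have hid : ocap D V `<=` pdom (idmor X) `&` pfun (idmor X) @^-1` V.
  by move=> x [].
have hf : ocap D V `<=` pdom f `&` pfun f @^-1` (ppre g V).
  by move=> x /hgf [[? ?] ?].
have gV0 : ppre g V !=set0 by case: W0 => y /h ?; exists y.
exists (ppre g V), gV0, (ocap D V), N0, hf.
exists (psharp g (@subset_refl _ (ppre g V)) s).
split.
  by rewrite (ratof_res gV0 W0 h) (psharp_res _ h (@subset_refl _ V)) res_id.
rewrite (ratof_res V0 N0 (@ocapr _ D V)); congr ratof.
have /= sE := sgf V (ocap D V) hid hgf s (@ocapl _ D V).
(* For [idmor], [psharp] is restriction along another proof of the same inclusion. *)
transitivity (psharp (idmor X) hid s).
  by congr (res _ s); exact: Prop_irrelevance.
rewrite [LHS]sE; congr (psharp f _ _); exact: Prop_irrelevance.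
Qed.

Section OrderAtOne.
Variable K : fieldType.
Local Notation tofrac := (@FracField.tofrac {poly K}).

Lemma tofrac_denomM (r : {fraction {poly K}}) :
  tofrac \d_(repr r) * r = tofrac \n_(repr r).
Proof.
set x := repr r; rewrite -[r]reprK -/x; unlock FracField.tofrac.
rewrite -[LHS]FracField.pi_mul; apply/eqP.
rewrite FracField.equivf_def /FracField.mulf.
by rewrite !numden_Ratio ?mul1r ?oner_neq0 ?denom_ratioP // mulr1 mulrC.
Qed.

(** The numerator vanishes at 1 to an order [m] below that of the denominator. Cancelling
    [('X - 1) ^+ m] leaves [p] over a denominator that still has a factor ['X - 1]. *)
Lemma notin_O_nu (r : {fraction {poly K}}) : ~ O_nu r ->
  exists p q : {poly K},
    p.[1] != 0 /\ tofrac (q * ('X - 1)) * r = tofrac p.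
Proof.
move=> Or.
(* Zero lies in [O_nu] by its first clause. So both polynomials are nonzero, and [mup] is their true
   multiplicity at 1. *)
have r0 : r != 0 by apply/eqP => r0; apply: Or; left.
have d0 : \d_(repr r) != 0 := denom_ratioP _.
have n0 : \n_(repr r) != 0.
  by rewrite -tofrac_eq0 -tofrac_denomM mulf_neq0 ?tofrac_eq0.
have lt_nd : (mup 1 \n_(repr r) < mup 1 \d_(repr r))%N.
  rewrite ltnNge; apply/negP => le_dn; apply: Or; right.
  by rewrite /ord1 Num.Theory.subr_ge0.
have [m [p]] := multiplicity_XsubC \n_(repr r) 1; rewrite n0 /= => p1 nE.
have mE : mup 1 \n_(repr r) = m by rewrite nE mupMr // mup_XsubCX eqxx.
have /dvdpP[q dE] : ('X - 1%:P) ^+ m.+1 %| \d_(repr r).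
  by rewrite -mup_geq // -mE.
exists p, q; split; first exact: p1.
have X0 : tofrac (('X - 1%:P) ^+ m) != 0.
  by rewrite tofrac_eq0 expf_neq0 ?polyXsubC_eq0.
apply: (mulIf X0); rewrite -tofracM -nE -tofrac_denomM dE exprS polyC1.
by rewrite mulrAC -tofracM mulrA.
Qed.

End OrderAtOne.

(** Constants and ['X] generate the polynomial ring, and [pulls_back] respects sums and products. It
    is used with [c = 1]. *)
Lemma pulls_back_horner (k : fieldType) (Y X : variety k) (f : pmor Y X)
    (iota : {rmorphism {poly ratfun Y} -> ratfun X}) (c : ratfun Y) :
  (forall a, pulls_back f (iota a%:P) a) -> pulls_back f (iota 'X) c ->
  forall p, pulls_back f (iota p) p.[c].
Proof.
move=> fC fX; elim/poly_ind => [|p a IH].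
  by rewrite horner0 -polyC0; exact: fC.
rewrite hornerMXaddC rmorphD rmorphM.
by apply: pulls_backD (fC a); apply: pulls_backM.
Qed.

Theorem corollary2p2 (k : closedFieldType) (char0 : [pchar k] =i pred0)
  (Gm : variety k) (t : sec Gm (ofull Gm)) (hGm : is_Gm t)
  (X : variety k)
  (P : variety k) (p1 : mor P Gm) (p2 : mor P X) (hP : is_product p1 p2)
  (P2 : variety k) (q1 : mor P2 Gm) (q2 : mor P2 P) (hP2 : is_product q1 q2)
  (phi : ratmap P X) (hphi : is_rational_action t p1 p2 q1 q2 phi)
  (phis : {rmorphism ratfun X -> {fraction {poly ratfun X}}})
  (hphis : is_comorphism t p1 p2 phi phis) :
  range phis `<=` O_nu (K := ratfun X).
Proof.
move=> _ [a _ <-]; apply: contrapT => /notin_O_nu[p [q [p10 rE]]].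
have [_ [e [[et p2e] [phi' [e' [phiE eE _ idE]]]]]] := hphi.
have [iota [_ iotaC iotaX iotaphi]] := hphis.
have e'E := rat_eq_sym eE.
have p2eE : Defs.rat_eq (idmor X) (Defs.pcomp p2 e).
  by apply: rat_eq_sym; exists (ofull X); first exact: full_ne.
pose pb := pulls_back e.
have eC b : pb (iota (FracField.tofrac b%:P)) b.
  exact: pulls_back_section p2eE (iotaC b).
have eX : pb (iota (FracField.tofrac 'X)) 1.
  rewrite iotaX; exists (ofull P), (full_ne P), (ofull X), (full_ne X).
  exists (mor_sub e), (gpull p1 t); split=> //.
  by rewrite -[psharp _ _ _]/(gpull e (gpull p1 t)) et.
(* The representatives [phi'] and [e'] compose to the identity, so [e'] is a section of [phi']; the
   result is then carried over to [e]. *)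
have er : pb (iota (phis a)) a.
  apply: pulls_back_rat_eq e'E _.
  exact: pulls_back_section idE (pulls_back_rat_eq phiE (iotaphi a)).
have epoly := pulls_back_horner (iota := iota \o @FracField.tofrac _) eC eX.
(* The element [q (t - 1) r - p] is zero, and it pulls back to [q(1) * 0 * a - p(1)], which must
   then vanish. *)
have := pulls_backD (pulls_backM (epoly (q * ('X - 1))) er) (epoly (- p)).
rewrite /= -rmorphM rE -rmorphD tofracN subrr rmorph0 => /pulls_back0.
rewrite hornerN hornerM hornerD hornerX hornerN hornerC subrr mulr0 mul0r add0r.
by move=> /eqP; rewrite oppr_eq0 (negPf p10).
Qed.
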